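(* Let $A(\underline{y})$ and $B(\underline{y})$ be smooth $\mathbb{R}_{0,m}$-valued functions depending only on $\underline{y}$. The function $$F(X)=\exp(z)A(\underline{y})+\exp(\overline{z})B(\underline{y})$$ is two-sided monogenic if and only if $A$ is harmonic and satisfies $A+e_1Ae_1+A\partial_{\underline{y}}=0$, and $B$ is a left monogenic function (i.e. $\partial_{\underline{y}}B=0$) of the form $B=-\frac{1}{2}\partial_{\underline{y}}A$. In particular, if $M(\underline{y})$ is a right monogenic function of $\underline{y}$ (i.e. $M\partial_{\underline{y}}=0$), then $$\exp(z)\big(M(\underline{y})-e_1M(\underline{y})e_1\big)-\frac{1}{2}\exp(\overline{z})\big(\partial_{\underline{y}}M(\underline{y})+e_1\partial_{\underline{y}}M(\underline{y})e_1\big)$$ is two-sided monogenic.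
   Context: Let $m\ge 2$ and let $\mathbb{R}_{0,m}$ be the real Clifford algebra generated by $e_1,\dots,e_m$ with $e_i^2=-1$ and $e_ie_j=-e_je_i$ for $i\neq j$; all products are Clifford products. Identify $(x_0,\dots,x_m)\in\mathbb{R}^{m+1}$ with $X=x_0+\sum_{j=1}^m x_je_j$, and write $z=x_0+x_1e_1$, $\overline{z}=x_0-x_1e_1$, $\underline{y}=\sum_{j=2}^m x_je_j$ (identified with $(x_2,\dots,x_m)\in\mathbb{R}^{m-1}$). The subalgebra spanned by $1,e_1$ is identified with $\mathbb{C}$ via $i\mapsto e_1$, so $\exp(z)=e^{x_0}(\cos x_1+e_1\sin x_1)$ and $\exp(\overline{z})=e^{x_0}(\cos x_1-e_1\sin x_1)$. Operators: $\partial_X f=\partial_{x_0}f+\sum_{j=1}^m e_j\partial_{x_j}f$, $f\partial_X=\partial_{x_0}f+\sum_{j=1}^m(\partial_{x_j}f)e_j$, $\partial_{\underline{y}}f=\sum_{j=2}^m e_j\partial_{x_j}f$, $f\partial_{\underline{y}}=\sum_{j=2}^m(\partial_{x_j}f)e_j$. A function $f$ is left monogenic if $\partial_Xf=0$, right monogenic if $f\partial_X=0$, two-sided monogenic if both hold; for functions of $\underline{y}$ alone, left/right monogenic means $\partial_{\underline{y}}f=0$ / $f\partial_{\underline{y}}=0$. Harmonic means $\Delta A=0$ where $\Delta=\sum_{j=2}^m\partial_{x_j}^2=-\partial_{\underline{y}}^2$. *)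

(* Defs.v *)
From HB Require Import structures.
From mathcomp Require Import all_boot all_order all_algebra.
From mathcomp Require Import all_classical all_reals all_analysis.
From mathcomp Require Import matrix_normedtype.
Import numFieldNormedType.Exports.
Set Implicit Arguments. Unset Strict Implicit. Unset Printing Implicit Defensive.
Import Order.TTheory GRing.Theory Num.Theory.
Local Open Scope ring_scope.

(* An element is a family of real coefficients indexed by the basis blades
   e_S, S a subset of {0,..,m-1}; the ordinal i stands for the paper's
   generator e_{i+1}.  e_S is the ordered product of the e_i, i in S,
   in increasing order; e_{set0} = 1. *)
Definition Cl (R : realType) (m : nat) := {ffun {set 'I_m} -> R}.

Definition symdiff m (A B : {set 'I_m}) : {set 'I_m} := (A :\: B) :|: (B :\: A).

(* e_A e_B = sign A B * e_{A symdiff B}, with e_i^2 = -1, e_i e_j = - e_j e_i *)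
Definition blade_sign (R : realType) m (A B : {set 'I_m}) : R :=
  (-1) ^+ (#|[set p : 'I_m * 'I_m | [&& p.1 \in A, p.2 \in B & (val p.2 < val p.1)%N]]| + #|A :&: B|).

Definition cmul (R : realType) m (x y : Cl R m) : Cl R m :=
  [ffun C => \sum_(A : {set 'I_m}) \sum_(B : {set 'I_m} | symdiff A B == C)
              blade_sign R A B * x A * y B].

Definition blade (R : realType) m (S : {set 'I_m}) : Cl R m :=
  [ffun A => if A == S then 1 else 0].

(* gen k = e_k of the paper for 1 <= k <= m, and gen 0 = 1 *)
Definition gen (R : realType) m (k : nat) : Cl R m :=
  blade R [set i : 'I_m | (val i).+1 == k].

Definition cscal (R : realType) m (c : R) : Cl R m := c *: blade R (finset.set0 : {set 'I_m}).

Definition expz (R : realType) m (x0 x1 : R) : Cl R m :=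
  cscal m (expR x0 * cos x1) + (expR x0 * sin x1) *: gen R m 1.
Definition expzbar (R : realType) m (x0 x1 : R) : Cl R m :=
  cscal m (expR x0 * cos x1) - (expR x0 * sin x1) *: gen R m 1.

Definition rpart (R : realType) n (i : 'I_n) (f : 'rV[R]_n -> R) : 'rV[R]_n -> R :=
  fun x => derive f x (delta_mx 0 i).

Definition iter_rpart (R : realType) n (l : seq 'I_n) (f : 'rV[R]_n -> R) :=
  foldr (fun i g => rpart i g) f l.

Definition cpart (R : realType) n m (i : 'I_n) (g : 'rV[R]_n -> Cl R m)
  : 'rV[R]_n -> Cl R m :=
  fun x => [ffun S => rpart i (fun y => g y S) x].

Definition csmooth (R : realType) n m (g : 'rV[R]_n -> Cl R m) : Prop :=
  forall (l : seq 'I_n) (S : {set 'I_m}) (x : 'rV[R]_n),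
    differentiable (iter_rpart l (fun y => g y S)) x.

(* X = (x_0,...,x_m) in R^{m+1} is a row vector 'rV_(m.+1);
   coordinate x_k is X 0 (inord k). *)
Definition DXl (R : realType) m (F : 'rV[R]_(m.+1) -> Cl R m) X : Cl R m :=
  \sum_(k < m.+1) cmul (gen R m k) (cpart k F X).
Definition DXr (R : realType) m (F : 'rV[R]_(m.+1) -> Cl R m) X : Cl R m :=
  \sum_(k < m.+1) cmul (cpart k F X) (gen R m k).

(* y = (x_2,...,x_m) in R^{m-1}; its i-th coordinate is x_{i+2} *)
Definition Dyl (R : realType) m (f : 'rV[R]_(m.-1) -> Cl R m) y : Cl R m :=
  \sum_(i < m.-1) cmul (gen R m (i + 2)) (cpart i f y).
Definition Dyr (R : realType) m (f : 'rV[R]_(m.-1) -> Cl R m) y : Cl R m :=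
  \sum_(i < m.-1) cmul (cpart i f y) (gen R m (i + 2)).

Definition two_sided_monogenic (R : realType) m (F : 'rV[R]_(m.+1) -> Cl R m) : Prop :=
  (forall X, DXl F X = 0) /\ (forall X, DXr F X = 0).

Definition left_monogenic_y (R : realType) m (f : 'rV[R]_(m.-1) -> Cl R m) : Prop :=
  forall y, Dyl f y = 0.
Definition right_monogenic_y (R : realType) m (f : 'rV[R]_(m.-1) -> Cl R m) : Prop :=
  forall y, Dyr f y = 0.

Definition harmonic_y (R : realType) m (f : 'rV[R]_(m.-1) -> Cl R m) : Prop :=
  forall y, \sum_(i < m.-1) cpart i (cpart i f) y = 0.

Definition yproj (R : realType) m (X : 'rV[R]_(m.+1)) : 'rV[R]_(m.-1) :=
  \row_(i < m.-1) X 0 (inord (i + 2)).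

Definition Fexp (R : realType) m (A B : 'rV[R]_(m.-1) -> Cl R m) (X : 'rV[R]_(m.+1))
  : Cl R m :=
  cmul (expz m (X 0 (inord 0)) (X 0 (inord 1))) (A (yproj X))
  + cmul (expzbar m (X 0 (inord 0)) (X 0 (inord 1))) (B (yproj X)).

(* Main.v *)
Require Import Defs.
From HB Require Import structures.
From mathcomp Require Import all_boot all_order all_algebra.
From mathcomp Require Import all_classical all_reals all_analysis.
From mathcomp Require Import matrix_normedtype.
From mathcomp Require Import ring.
Import numFieldNormedType.Exports.
Import Order.TTheory GRing.Theory Num.Theory.
Local Open Scope ring_scope.

Set Implicit Arguments.
Unset Strict Implicit.
Unset Printing Implicit Defensive.

(* With [e = e_1], splitting [exp z] and [exp zbar] into cosine and sine parts
   gives [F = e^x0 cos x1 P(y) + e^x0 sin x1 Q(y)] where [P = A + B] and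
   [Q = e (A - B)].  Then [DXl F] is the same expression built on
   [P + e Q + Dyl P] and [Q - e P + Dyl Q], and a function of this shape vanishes
   iff both of its components do.  Adding and subtracting the two conditions turns
   left monogenicity into [2 B + Dyl A = 0], [Dyl B = 0] and right monogenicity
   into [A + e A e + Dyr A = 0], [B - e B e + Dyr B = 0].  Symmetry of second
   partial derivatives yields [Dyl (Dyl A) = - Laplacian A], which trades
   [Dyl B = 0] for harmonicity, and [Dyl (Dyr A) = Dyr (Dyl A)], which derives
   the second right equation from the first one. *)

(** * The Clifford product *)

(** The two cardinals differ by twice that of the intersection, so parities add. The type [T] is
    kept general because pairs of indices are counted too. *)
Lemma signr_symdiff (R : pzRingType) (T : finType) (X Y : {set T}) :
  (-1) ^+ #|(X :\: Y) :|: (Y :\: X)| = (-1) ^+ #|X| * (-1) ^+ #|Y| :> R.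
Proof.
have XY0 : (X :\: Y) :&: (Y :\: X) = finset.set0.
  by apply/setP => x; rewrite !inE; case: (x \in X); case: (x \in Y).
rewrite -exprD cardsU XY0 cards0 subn0 -(cardsID Y X) -(cardsID X Y) (finset.setIC Y X).
by rewrite addnACA [RHS]exprD addnn -mul2n exprM sqrrN !expr1n mul1r.
Qed.

Section CliffordProduct.
Variables (R : realType) (m : nat).
Implicit Types (A B C : {set 'I_m}) (x y z : Cl R m).

Lemma in_symdiff A B i : (i \in symdiff A B) = (i \in A) (+) (i \in B).
Proof. by rewrite !inE; case: (i \in A); case: (i \in B). Qed.

Lemma symdiffA A B C : symdiff A (symdiff B C) = symdiff (symdiff A B) C.
Proof. by apply/setP => i; rewrite !in_symdiff addbA. Qed.

Lemma symdiffC A B : symdiff A B = symdiff B A.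
Proof. by apply/setP => i; rewrite !in_symdiff addbC. Qed.

Lemma symdiffK A : cancel (symdiff A) (symdiff A).
Proof. by move=> B; apply/setP => i; rewrite !in_symdiff addKb. Qed.

Lemma symdiff0 A : symdiff A finset.set0 = A.
Proof. by apply/setP => i; rewrite in_symdiff inE addbF. Qed.

Lemma symdiffv A : symdiff A A = finset.set0.
Proof. by apply/setP => i; rewrite in_symdiff inE addbb. Qed.

(* Bimultiplicativity on the group of subsets under [symdiff] gives the cocycle
   identity behind associativity. *)
Lemma blade_signDl A B C :
  blade_sign R (symdiff A B) C = blade_sign R A C * blade_sign R B C.
Proof.
rewrite /blade_sign !exprD mulrACA -!signr_symdiff.
(* The inversions and the common indices for [symdiff A B] are the symmetric differences of those
   for [A] and for [B], as membership shows pointwise. *)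
congr (_ ^+ _ * _ ^+ _); apply: eq_card => p; rewrite !inE;
  by case: (_ \in A); case: (_ \in B); case: (_ \in C); rewrite ?andbF //=; case: ltnP.
Qed.

Lemma blade_signDr A B C :
  blade_sign R A (symdiff B C) = blade_sign R A B * blade_sign R A C.
Proof.
rewrite /blade_sign !exprD mulrACA -!signr_symdiff.
congr (_ ^+ _ * _ ^+ _); apply: eq_card => p; rewrite !inE;
  by case: (_ \in A); case: (_ \in B); case: (_ \in C); rewrite ?andbF //=; case: ltnP.
Qed.

(** As [symdiff A] is an involution, [B = symdiff A C] is the only index contributing to the inner
    sum. *)
Lemma cmulE x y C :
  cmul x y C =
  \sum_A blade_sign R A (symdiff A C) * x A * y (symdiff A C).
Proof.
rewrite ffunE; apply: eq_bigr => A _; rewrite (big_pred1 (symdiff A C)) // => B.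
by rewrite /= -(inj_eq (can_inj (symdiffK A))) symdiffK.
Qed.

Lemma cmulA x y z : cmul x (cmul y z) = cmul (cmul x y) z.
Proof.
apply/ffunP => D; rewrite !cmulE.
under eq_bigr do rewrite cmulE big_distrr /=.
under [RHS]eq_bigr do rewrite cmulE big_distrr big_distrl /=.
rewrite [RHS]exchange_big /=; apply: eq_bigr => A _.
(* On the right the outer index is the blade of the product of [e_A] and [e_B]; renaming it
   [symdiff A B] aligns the two double sums. *)
rewrite [RHS](reindex_inj (can_inj (symdiffK A))) /=; apply: eq_bigr => B _.
rewrite symdiffK (symdiffC A B) -symdiffA blade_signDl.
(* With [u = symdiff B (symdiff A D)], both sides now carry the signs of the pairs [(A, B)],
   [(A, u)] and [(B, u)]. *)
have -> : symdiff A D = symdiff B (symdiff B (symdiff A D)) by rewrite symdiffK.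
rewrite blade_signDr symdiffK; set u := symdiff B _.
ring.
Qed.

Fact cmul_linear x : linear (cmul x).
Proof.
move=> a y z; apply/ffunP => C; rewrite cmulE [RHS]ffunE [X in _ = X + _]ffunE !cmulE.
rewrite scaler_sumr -big_split /=.
apply: eq_bigr => A _; rewrite !ffunE mulrDr; congr (_ + _).
by rewrite /GRing.scale /=; ring.
Qed.

HB.instance Definition _ x :=
  GRing.isLinear.Build R (Cl R m) (Cl R m) _ (cmul x) (cmul_linear x).

(** Right multiplication by [y] as a map of its own, so that it can carry a linear structure. *)
Definition cmulr y x := cmul x y.

Fact cmulr_linear y : linear (cmulr y).
Proof.
move=> a x z; apply/ffunP => C; rewrite cmulE [RHS]ffunE [X in _ = X + _]ffunE !cmulE.
rewrite scaler_sumr -big_split /=.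
apply: eq_bigr => A _; rewrite !ffunE mulrDr mulrDl; congr (_ + _).
by rewrite /GRing.scale /=; ring.
Qed.

HB.instance Definition _ y :=
  GRing.isLinear.Build R (Cl R m) (Cl R m) _ (cmulr y) (cmulr_linear y).

Lemma cmulDl x y z : cmul (x + y) z = cmul x z + cmul y z.
Proof. exact: (linearD (cmulr z)). Qed.

Lemma cmul0l z : cmul 0 z = 0.
Proof. exact: (linear0 (cmulr z)). Qed.

Lemma cmulNl x z : cmul (- x) z = - cmul x z.
Proof. exact: (linearN (cmulr z)). Qed.

Lemma cmulZl (a : R) x z : cmul (a *: x) z = a *: cmul x z.
Proof. exact: (linearZ_LR (cmulr z)). Qed.

Lemma cmulDr x y z : cmul x (y + z) = cmul x y + cmul x z.
Proof. exact: linearD. Qed.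

Lemma cmul0r x : cmul x 0 = 0.
Proof. exact: linear0. Qed.

Lemma cmulNr x z : cmul x (- z) = - cmul x z.
Proof. exact: linearN. Qed.

Lemma cmulZr (a : R) x z : cmul x (a *: z) = a *: cmul x z.
Proof. exact: linearZ_LR. Qed.

Lemma cmul_suml (J : finType) (F : J -> Cl R m) z :
  cmul (\sum_j F j) z = \sum_j cmul (F j) z.
Proof. exact: (linear_sum (cmulr z)). Qed.

(** * Basis blades, the unit and the relations between generators *)

Lemma blade_mul A B :
  cmul (blade R A) (blade R B) = blade_sign R A B *: blade R (symdiff A B).
Proof.
apply/ffunP => C; rewrite cmulE (bigD1 A) //= big1 ?addr0; last first.
  by move=> D /negbTE DA; rewrite !ffunE DA mulr0 mul0r.
rewrite !ffunE eqxx mulr1 -(inj_eq (can_inj (symdiffK A))) symdiffK.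
by case: eqP => [->|_]; rewrite ?symdiffK // !mulr0 scaler0.
Qed.

Lemma blade_expand x : x = \sum_A x A *: blade R A.
Proof.
apply/ffunP => C; rewrite sum_ffunE (bigD1 C) //= big1 ?addr0.
  by rewrite !ffunE eqxx /GRing.scale /= mulr1.
by move=> D DC; rewrite !ffunE eq_sym (negbTE DC) scaler0.
Qed.

(** The empty set is its own symmetric difference with itself, so by bimultiplicativity this sign is
    a square. *)
Lemma blade_sign0l A : blade_sign R finset.set0 A = 1.
Proof.
rewrite -[finset.set0](symdiffv finset.set0) blade_signDl /blade_sign -exprD addnn.
by rewrite -mul2n exprM sqrrN !expr1n.
Qed.

Lemma blade_sign0r A : blade_sign R A finset.set0 = 1.
Proof.
rewrite -[finset.set0](symdiffv finset.set0) blade_signDr /blade_sign -exprD addnn.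
by rewrite -mul2n exprM sqrrN !expr1n.
Qed.

Lemma gen0 : gen R m 0 = blade R finset.set0.
Proof. by congr blade; apply/setP => i; rewrite !inE. Qed.

Lemma cmul1l x : cmul (gen R m 0) x = x.
Proof.
rewrite gen0 {1}(blade_expand x) linear_sum [RHS]blade_expand; apply: eq_bigr => A _.
rewrite linearZ; rewrite -[LHS]/(_ *: cmul _ _).
by rewrite blade_mul blade_sign0l scale1r symdiffC symdiff0.
Qed.

Lemma cmul1r x : cmul x (gen R m 0) = x.
Proof.
rewrite gen0 {1}(blade_expand x) cmul_suml [RHS]blade_expand.
apply: eq_bigr => A _; rewrite cmulZl blade_mul blade_sign0r scale1r.
by rewrite symdiff0.
Qed.

Lemma gen_ord (i : 'I_m) : gen R m i.+1 = blade R [set i].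
Proof. by congr blade; apply/setP => j; rewrite !inE eqSS. Qed.

Lemma gen_sqr k : (0 < k <= m)%N -> cmul (gen R m k) (gen R m k) = - gen R m 0.
Proof.
case: k => // k /= km; rewrite -[k]/(val (Ordinal km)) gen_ord blade_mul gen0.
rewrite symdiffv -scaleN1r; congr (_ *: _).
rewrite /blade_sign finset.setIid cards1 [X in (X + _)%N](_ : _ = 0%N) //.
apply: eq_card0 => p; rewrite !inE; apply/negbTE/and3P => -[/eqP-> /eqP->].
by rewrite ltnn.
Qed.

Lemma gen_anticomm j k : (0 < j <= m)%N -> (0 < k <= m)%N -> j != k ->
  cmul (gen R m j) (gen R m k) = - cmul (gen R m k) (gen R m j).
Proof.
case: j k => // j [] // k /= jm km; rewrite eqSS => jk.
rewrite -[j]/(val (Ordinal jm)) -[k]/(val (Ordinal km)) !gen_ord !blade_mul.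
rewrite symdiffC -scaleNr; congr (_ *: _).
(* For distinct singletons the only possible inversion is the pair [(a, b)], so exactly one of the
   two orders gets the sign -1. *)
have E (a b : 'I_m) : a != b -> blade_sign R [set a] [set b] = (-1) ^+ (b < a)%N.
  move=> ab; rewrite /blade_sign [X in (_ + X)%N](_ : _ = 0%N).
    rewrite addn0; congr (_ ^+ _); case: ltnP => ba.
      rewrite -[RHS](card1 (a, b)); apply: eq_card => -[c d]; rewrite !inE /= xpair_eqE.
      by case: eqP => //= ->; case: eqP => //= ->; rewrite ba.
    apply: eq_card0 => -[c d]; rewrite !inE /=.
    by apply/negbTE/and3P => -[/eqP-> /eqP->]; rewrite ltnNge ba.
  apply: eq_card0 => c; rewrite !inE; apply/negbTE/andP => -[/eqP-> /eqP abE].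
  by rewrite abE eqxx in ab.
rewrite !E //=; last by rewrite -val_eqE /= eq_sym.
by move: jk; case: ltngtP => //= _ _; rewrite ?opprK.
Qed.

End CliffordProduct.

(** * Symmetry of second derivatives *)

Section LineDerivative.
Variables (R : realType) (V V' W : normedModType R).

(* Both difference quotients are the same function of the step. *)
Lemma derive_reparam (f : V -> W) (g : V' -> W) a v b w :
  (forall h : R, f (h *: v + a) = g (h *: w + b)) ->
  (derivable f a v <-> derivable g b w) /\ 'D_v f a = 'D_w g b.
Proof.
move=> fg; have fagb : f a = g b by have := fg 0; rewrite !scale0r !add0r.
rewrite /derivable /derive.
suff -> : (fun h : R => h^-1 *: ((f \o shift a) (h *: v) - f a)) =
          (fun h : R => h^-1 *: ((g \o shift b) (h *: w) - g b)) by [].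
by apply: funext => h /=; rewrite fg fagb.
Qed.

Lemma is_derive_reparam (f : V -> W) (g : V' -> W) a v b w d :
  (forall h : R, f (h *: v + a) = g (h *: w + b)) ->
  is_derive b w g d -> is_derive a v f d.
Proof.
move=> /derive_reparam[[_ fg] E] gd; apply: DeriveDef; last by rewrite E derive_val.
exact/fg/ex_derive.
Qed.

End LineDerivative.

(** Turns a directional derivative into a derivative in one real variable, where the mean value
    theorem applies. *)
Lemma is_derive_line (R : realType) (V W : normedModType R) (f : V -> W)
    (x u : V) (t : R) :
  derivable f (x + t *: u) u ->
  is_derive t (1 : R) (fun s : R => f (x + s *: u)) ('D_u f (x + t *: u)).
Proof.
move=> /derivableP; apply: is_derive_reparam => h.
by rewrite [h *: 1]mulr1 scalerDl addrCA addrA.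
Qed.

(** * Equality of mixed directional derivatives, by second differences *)

Section Schwarz.
Variables (R : realType) (V : normedModType R).
Implicit Types (f : V -> R) (x u v : V).

(** The mean value theorem is used twice: on the increment [g] of [f] in direction [v], as a
    function of the step along [u], and then on ['D_u f] along [v]. *)
Lemma second_difference_MVT f x u v (h : R) : 0 < h ->
  (forall y, derivable f y u) -> (forall y, derivable ('D_u f) y v) ->
  exists c d : R, [/\ 0 < c < h, 0 < d < h &
    f (x + h *: u + h *: v) - f (x + h *: u) - f (x + h *: v) + f x =
    'D_v ('D_u f) (x + c *: u + d *: v) * h * h].
Proof.
move=> h0 fu fuv.
pose g (s : R) := f (x + h *: v + s *: u) - f (x + s *: u).
have dg (s : R) : is_derive s (1 : R) g
    ('D_u f (x + h *: v + s *: u) - 'D_u f (x + s *: u)).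
  by apply: is_deriveB; exact: is_derive_line.
have cg : continuous g.
  by move=> s; apply/differentiable_continuous/derivable1_diffP/ex_derive.
have [c] := MVT h0 (fun s _ => dg s) (continuous_subspaceT cg).
rewrite in_itv /= => ch; rewrite subr0 => gE.
pose k (s : R) := 'D_u f (x + c *: u + s *: v).
have dk (s : R) : is_derive s (1 : R) k ('D_v ('D_u f) (x + c *: u + s *: v)).
  exact: is_derive_line.
have ck : continuous k.
  by move=> s; apply/differentiable_continuous/derivable1_diffP/ex_derive.
have [d] := MVT h0 (fun s _ => dk s) (continuous_subspaceT ck).
rewrite in_itv /= => dh; rewrite subr0 => kE.
exists c, d; split => //; rewrite -kE /k scale0r addr0 (addrAC x (c *: u)) -gE /g.
by rewrite !scale0r !addr0 (addrAC x (h *: u)); ring.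
Qed.

(** The second difference is symmetric in [u] and [v], so near [x] the two mixed derivatives share a
    value. If they differed at [x], continuity would keep them apart nearby. *)
Lemma deriveC f x u v :
  (forall y, derivable f y u) -> (forall y, derivable f y v) ->
  (forall y, derivable ('D_u f) y v) -> (forall y, derivable ('D_v f) y u) ->
  {for x, continuous ('D_v ('D_u f))} -> {for x, continuous ('D_u ('D_v f))} ->
  'D_v ('D_u f) x = 'D_u ('D_v f) x.
Proof.
move=> fu fv fuv fvu cuv cvu; apply/eqP/negPn/negP => neq.
pose e := `|'D_v ('D_u f) x - 'D_u ('D_v f) x| / 2.
have e0 : 0 < e by rewrite divr_gt0 // normr_gt0 subr_eq0.
have [/= r1 r10 near1] := (nbhs_ballP _ _).1 (cuv _ (nbhsx_ballx _ _ e0)).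
have [/= r2 r20 near2] := (nbhs_ballP _ _).1 (cvu _ (nbhsx_ballx _ _ e0)).
(* Steps shorter than [h] along [u] and [v] stay in both balls; the summand 1 keeps the denominator
   positive and the bound strict. *)
pose h := Num.min r1 r2 / (1 + `|u| + `|v|).
have n0 : 0 < 1 + `|u| + `|v| by rewrite -addrA ltr_pwDl // addr_ge0.
have h0 : 0 < h by rewrite divr_gt0 // lt_min r10.
have small (r c d : R) w z : Num.min r1 r2 <= r -> `|w| + `|z| = `|u| + `|v| ->
    0 < c < h -> 0 < d < h -> ball x r (x + c *: w + d *: z).
  move=> hr wz /andP[c0 ch] /andP[d0 dh]; rewrite -ball_normE /ball_ /=.
  rewrite -addrA opprD addrA subrr add0r normrN.
  apply: le_lt_trans (ler_normD _ _) _; rewrite !normrZ !gtr0_norm //.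
  apply: lt_le_trans hr.
  have -> : Num.min r1 r2 = h * (1 + (`|w| + `|z|)).
    by rewrite wz addrA /h divfK // gt_eqF.
  rewrite mulrDr mulr1 ltr_pwDl // mulrDr.
  by rewrite lerD // ler_wpM2r // ltW.
have [c [d [ch dh E]]] := second_difference_MVT x h0 fu fuv.
have [c' [d' [ch' dh' E']]] := second_difference_MVT x h0 fv fvu.
have {E E'} E : 'D_v ('D_u f) (x + c *: u + d *: v) =
                'D_u ('D_v f) (x + c' *: v + d' *: u).
  apply: (mulIf (lt0r_neq0 h0)); apply: (mulIf (lt0r_neq0 h0)).
  apply: (etrans (esym E)); apply: (etrans _ E').
  by rewrite (addrAC x (h *: v)); congr (_ + _); exact: addrAC.
have := near1 _ (small r1 c d u v _ erefl ch dh); rewrite ge_min lexx => /(_ isT).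
have := near2 _ (small r2 c' d' v u _ (addrC _ _) ch' dh').
rewrite ge_min lexx orbT => /(_ isT) /=.
rewrite -!ball_normE /ball_ /= -E => B2 B1.
(* The common value lies within [e] of both derivatives at [x], whose distance is [2 e]: this
   contradicts the triangle inequality. *)
have := ltrD B1 B2; rewrite -splitr ltNge => /negP; apply.
rewrite [leLHS](_ : _ = `|('D_v ('D_u f) x - 'D_v ('D_u f) (x + c *: u + d *: v)) -
  ('D_u ('D_v f) x - 'D_v ('D_u f) (x + c *: u + d *: v))|); last first.
  by rewrite opprB addrA subrK.
exact: ler_normB.
Qed.

End Schwarz.

(** * Smooth Clifford-valued functions *)

Section SmoothScalar.
Variables (R : realType) (n : nat).
Implicit Types (f g : 'rV[R]_n -> R) (x v : 'rV[R]_n).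

Definition smooth f :=
  forall (l : seq 'I_n) x, differentiable (iter_rpart l f) x.

Lemma smooth_derivable f x v : smooth f -> derivable f x v.
Proof. by move=> /(_ [::] x) ?; exact: diff_derivable. Qed.

Lemma smooth_rpart i f : smooth f -> smooth (rpart i f).
(* [foldr] applies the last index of the list first, hence [rcons]. *)
Proof. by move=> fs l; have := fs (rcons l i); rewrite /iter_rpart foldr_rcons. Qed.

(** Constant linear combinations cover both the action of a linear map on coefficients and finite
    sums. *)
Lemma is_derive_lincomb (J : Type) (r : seq J) (c : J -> R)
    (f : J -> 'rV[R]_n -> R) (df : J -> R) x v :
  (forall j, is_derive x v (f j) (df j)) ->
  is_derive x v (fun y => \sum_(j <- r) c j * f j y) (\sum_(j <- r) c j * df j).
Proof.
move=> fdf; elim: r => [|j r IH].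
  rewrite big_nil [X in is_derive _ _ X _](_ : _ = cst 0); first exact: is_derive_cst.
  by apply: funext => y; rewrite big_nil.
rewrite big_cons [X in is_derive _ _ X _](_ : _ =
  (c j \*: f j) + (fun y => \sum_(j <- r) c j * f j y)); first exact: is_deriveD.
by apply: funext => y; rewrite big_cons.
Qed.

Lemma differentiable_lincomb (J : Type) (r : seq J) (c : J -> R)
    (f : J -> 'rV[R]_n -> R) x :
  (forall j, differentiable (f j) x) ->
  differentiable (fun y => \sum_(j <- r) c j * f j y) x.
Proof.
move=> fd; elim: r => [|j r IH].
  rewrite [X in differentiable X _](_ : _ = cst 0) //.
  by apply: funext => y; rewrite big_nil.
rewrite [X in differentiable X _](_ : _ =
  (c j \*: f j) + (fun y => \sum_(j <- r) c j * f j y)).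
  by apply: differentiableD => //; exact: differentiableZ.
by apply: funext => y; rewrite big_cons.
Qed.

Lemma rpart_lincomb (J : Type) (r : seq J) (c : J -> R)
    (f : J -> 'rV[R]_n -> R) i : (forall j, smooth (f j)) ->
  rpart i (fun y => \sum_(j <- r) c j * f j y) =
  (fun y => \sum_(j <- r) c j * rpart i (f j) y).
Proof.
move=> fs; apply: funext => y; apply: derive_val; apply: is_derive_lincomb => j.
exact/derivableP/smooth_derivable.
Qed.

Lemma smooth_lincomb (J : Type) (r : seq J) (c : J -> R)
    (f : J -> 'rV[R]_n -> R) : (forall j, smooth (f j)) ->
  smooth (fun y => \sum_(j <- r) c j * f j y).
Proof.
move=> fs l; suff -> : iter_rpart l (fun y => \sum_(j <- r) c j * f j y) =
    (fun y => \sum_(j <- r) c j * iter_rpart l (f j) y).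
  by move=> x; apply: differentiable_lincomb => j; exact: fs.
elim: l => [|i l IH] //=; rewrite IH rpart_lincomb // => j l'.
by rewrite /iter_rpart -foldr_cat; exact: fs.
Qed.

Lemma rpartC i j f x : smooth f -> rpart i (rpart j f) x = rpart j (rpart i f) x.
Proof.
move=> fs; rewrite /rpart; apply: deriveC => [y|y|y|y||].
- exact: smooth_derivable.
- exact: smooth_derivable.
- exact: (smooth_derivable (smooth_rpart j fs)).
- exact: (smooth_derivable (smooth_rpart i fs)).
- exact: (differentiable_continuous (fs [:: i; j] x)).
- exact: (differentiable_continuous (fs [:: j; i] x)).
Qed.

End SmoothScalar.

(** * Clifford-valued functions, treated coefficient by coefficient *)

Section SmoothClifford.
Variables (R : realType) (m n : nat).
Implicit Types (f g : 'rV[R]_n -> Cl R m) (i : 'I_n) (y : 'rV[R]_n).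

Lemma csmoothP f : csmooth f <-> forall S, smooth (fun y => f y S).
Proof. by split=> fs *; move=> *; exact: fs. Qed.

Lemma cpart_coef i f S : (fun y => cpart i f y S) = rpart i (fun y => f y S).
Proof. by apply: funext => y; rewrite ffunE. Qed.

Lemma csmooth_cpart i f : csmooth f -> csmooth (cpart i f).
Proof.
move=> /csmoothP fs; apply/csmoothP => S.
by rewrite cpart_coef; exact: smooth_rpart.
Qed.

Lemma cpartC i j f y : csmooth f -> cpart i (cpart j f) y = cpart j (cpart i f) y.
Proof.
move=> /csmoothP fs; apply/ffunP => S; rewrite [LHS]ffunE [RHS]ffunE !cpart_coef.
exact: rpartC.
Qed.

(** Expanding [f y] in blades reduces differentiation under [T] to scalar linear combinations. *)
Lemma linear_coef (T : {linear Cl R m -> Cl R m}) (f : 'rV[R]_n -> Cl R m) S :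
  (fun y => T (f y) S) = (fun y => \sum_A T (blade R A) S * f y A).
Proof.
apply: funext => y; rewrite {1}(blade_expand (f y)) linear_sum sum_ffunE.
by apply: eq_bigr => A _; rewrite linearZ ffunE mulrC.
Qed.

Lemma csmooth_linear (T : {linear Cl R m -> Cl R m}) f :
  csmooth f -> csmooth (fun y => T (f y)).
Proof.
move=> /csmoothP fs; apply/csmoothP => S.
by rewrite linear_coef; exact: smooth_lincomb.
Qed.

Lemma cpart_linear (T : {linear Cl R m -> Cl R m}) i f y :
  csmooth f -> cpart i (fun y => T (f y)) y = T (cpart i f y).
Proof.
move=> /csmoothP fs; apply/ffunP => S; rewrite ffunE linear_coef rpart_lincomb //.
rewrite (congr1 (@^~ y) (linear_coef T (cpart i f) S)).
by apply: eq_bigr => A _; rewrite ffunE.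
Qed.

Lemma sum_coef (J : finType) (f : J -> 'rV[R]_n -> Cl R m) S :
  (fun y => (\sum_j f j y) S) = (fun y => \sum_j 1 * f j y S).
Proof.
by apply: funext => y; rewrite sum_ffunE; apply: eq_bigr => j _; rewrite mul1r.
Qed.

Lemma csmooth_sum (J : finType) (f : J -> 'rV[R]_n -> Cl R m) :
  (forall j, csmooth (f j)) -> csmooth (fun y => \sum_j f j y).
Proof.
move=> fs; apply/csmoothP => S; rewrite sum_coef; apply: smooth_lincomb => j.
exact: ((csmoothP _).1 (fs j)).
Qed.

Lemma cpart_sum (J : finType) (f : J -> 'rV[R]_n -> Cl R m) i y :
  (forall j, csmooth (f j)) ->
  cpart i (fun y => \sum_j f j y) y = \sum_j cpart i (f j) y.
Proof.
move=> fs; apply/ffunP => S; rewrite ffunE sum_coef rpart_lincomb ?sum_ffunE.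
  by apply: eq_bigr => j _; rewrite ffunE mul1r.
by move=> j; exact: ((csmoothP _).1 (fs j)).
Qed.

(** Lets the rules for finite sums cover binary ones. *)
Lemma addE_big_bool f g : (fun y => f y + g y) = (fun y => \sum_b (if b then f else g) y).
Proof. by apply: funext => y; rewrite big_bool. Qed.

Lemma csmoothD f g : csmooth f -> csmooth g -> csmooth (fun y => f y + g y).
Proof. by move=> fs gs; rewrite addE_big_bool; apply: csmooth_sum => -[]. Qed.

Lemma cpartD f g i y : csmooth f -> csmooth g ->
  cpart i (fun y => f y + g y) y = cpart i f y + cpart i g y.
Proof.
by move=> fs gs; rewrite addE_big_bool cpart_sum ?big_bool // => -[].
Qed.

Lemma csmoothZ (c : R) f : csmooth f -> csmooth (fun y => c *: f y).
Proof. exact: (csmooth_linear ( *:%R c)). Qed.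

Lemma csmoothN f : csmooth f -> csmooth (fun y => - f y).
Proof. exact: (csmooth_linear -%R). Qed.

Lemma csmoothB f g : csmooth f -> csmooth g -> csmooth (fun y => f y - g y).
Proof. by move=> fs gs; apply: csmoothD => //; exact: csmoothN. Qed.

End SmoothClifford.

(** * The Dirac operators in y *)

(** Decouples the cosine and sine conditions, which involve [u + w] and [u - w]. *)
Lemma add_sub_eq0 (R : realType) (V : lmodType R) (u w : V) :
  (u + w = 0 /\ u - w = 0) <-> (u = 0 /\ w = 0).
Proof.
split=> [[uw /eqP]|[-> ->]]; last by rewrite subr0 addr0.
rewrite subr_eq0 => /eqP uE; move: uw; rewrite uE -mulr2n -scaler_nat => /eqP.
by rewrite scaler_eq0 pnatr_eq0 => /eqP ->.
Qed.

Lemma double_half_eq (R : realType) (V : lmodType R) (u v : V) :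
  u + u + v = 0 <-> u = - (2^-1 : R) *: v.
Proof.
have two0 : (2 : R) != 0 by rewrite pnatr_eq0.
split=> [/eqP|->].
  rewrite addr_eq0 -mulr2n -scaler_nat => /eqP uv; apply: (scalerI two0).
  by rewrite uv scaleNr scalerN scalerA divff // scale1r.
by rewrite -mulr2n -scaler_nat scaleNr scalerN scalerA divff // scale1r addNr.
Qed.

(** The algebraic core of the fact that the Dirac operator squares to minus the Laplacian: in the
    double sum plus its transpose, off-diagonal terms cancel and diagonal ones double. *)
Lemma sum_anticomm (R : realType) (V : lmodType R) (J : finType) (t : J -> J -> V -> V)
    (h : J -> J -> V) :
  (forall i j : J, h i j = h j i) -> (forall (i : J) (x : V), t i i x = - x) ->
  (forall (i j : J) (x : V), i != j -> t i j x = - t j i x) ->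
  \sum_i \sum_j t i j (h i j) = - \sum_i h i i.
Proof.
move=> hC tii tij; set s := LHS.
have s2 : s + s = - (\sum_i h i i) - \sum_i h i i.
  rewrite {2}/s exchange_big -big_split /= -sumrN -big_split; apply: eq_bigr => i _.
  rewrite -big_split (bigD1 i) //= big1 ?addr0 ?tii // => j ij.
  by rewrite (tij i j) 1?eq_sym // hC addNr.
have two0 : (2 : R) != 0 by rewrite pnatr_eq0.
by apply: (scalerI two0); rewrite !scaler_nat !mulr2n.
Qed.

Section Dirac.
Variables (R : realType) (m : nat).
Implicit Types (f g : 'rV[R]_m.-1 -> Cl R m) (T : {linear Cl R m -> Cl R m}).
Implicit Types (i j : 'I_m.-1) (y : 'rV[R]_m.-1).

Lemma ord_gen_bound i : (0 < i + 2 <= m)%N.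
Proof. by rewrite addn2 /=; have := ltn_ord i; rewrite -ltnS; case: m i => [[]|]. Qed.

Lemma csmooth_Dyl f : csmooth f -> csmooth (Dyl f).
Proof.
move=> fs; apply: csmooth_sum => i.
exact: (csmooth_linear (cmul (gen R m (i + 2))) (csmooth_cpart i fs)).
Qed.

Lemma csmooth_Dyr f : csmooth f -> csmooth (Dyr f).
Proof.
move=> fs; apply: csmooth_sum => i.
exact: (csmooth_linear (cmulr (gen R m (i + 2))) (csmooth_cpart i fs)).
Qed.

(** The factor [a] is 1 when [T] commutes with multiplication by the generators and -1 when it
    anticommutes. *)
Lemma Dyl_linear T (a : R) f y :
  (forall i x, cmul (gen R m (i + 2)) (T x) = a *: T (cmul (gen R m (i + 2)) x)) ->
  csmooth f -> Dyl (fun y => T (f y)) y = a *: T (Dyl f y).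
Proof.
move=> Ta fs; rewrite /Dyl linear_sum scaler_sumr; apply: eq_bigr => i _.
by rewrite cpart_linear.
Qed.

Lemma Dyr_linear T (a : R) f y :
  (forall i x, cmul (T x) (gen R m (i + 2)) = a *: T (cmul x (gen R m (i + 2)))) ->
  csmooth f -> Dyr (fun y => T (f y)) y = a *: T (Dyr f y).
Proof.
move=> Ta fs; rewrite /Dyr linear_sum scaler_sumr; apply: eq_bigr => i _.
by rewrite cpart_linear.
Qed.

Lemma DylD f g y : csmooth f -> csmooth g ->
  Dyl (fun y => f y + g y) y = Dyl f y + Dyl g y.
Proof.
move=> fs gs; rewrite /Dyl -big_split; apply: eq_bigr => i _.
by rewrite cpartD // linearD.
Qed.

Lemma DyrD f g y : csmooth f -> csmooth g ->
  Dyr (fun y => f y + g y) y = Dyr f y + Dyr g y.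
Proof.
move=> fs gs; rewrite /Dyr -big_split; apply: eq_bigr => i _.
by rewrite cpartD // cmulDl.
Qed.

Lemma DylZ (c : R) f y : csmooth f -> Dyl (fun y => c *: f y) y = c *: Dyl f y.
Proof.
move=> fs; rewrite (@Dyl_linear ( *:%R c) 1) ?scale1r // => i x.
by rewrite scale1r linearZ.
Qed.

Lemma DyrZ (c : R) f y : csmooth f -> Dyr (fun y => c *: f y) y = c *: Dyr f y.
Proof.
move=> fs; rewrite (@Dyr_linear ( *:%R c) 1) ?scale1r // => i x.
by rewrite scale1r cmulZl.
Qed.

Lemma DylB f g y : csmooth f -> csmooth g ->
  Dyl (fun y => f y - g y) y = Dyl f y - Dyl g y.
Proof.
move=> fs gs; rewrite DylD //; last exact: csmoothN.
rewrite -[X in _ = _ + X]scaleN1r -DylZ //; congr (_ + Dyl _ y).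
by apply: funext => z; rewrite scaleN1r.
Qed.

Lemma DyrB f g y : csmooth f -> csmooth g ->
  Dyr (fun y => f y - g y) y = Dyr f y - Dyr g y.
Proof.
move=> fs gs; rewrite DyrD //; last exact: csmoothN.
rewrite -[X in _ = _ + X]scaleN1r -DyrZ //; congr (_ + Dyr _ y).
by apply: funext => z; rewrite scaleN1r.
Qed.

Lemma cpart_cst0 i y : cpart i (fun=> 0 : Cl R m) y = 0.
Proof.
apply/ffunP => S; rewrite [LHS]ffunE [RHS]ffunE.
rewrite [X in rpart i X](_ : _ = cst 0) /rpart ?derive_cst // funeqE => z.
by rewrite ffunE.
Qed.

Lemma Dyl0 y : Dyl (fun=> 0 : Cl R m) y = 0.
Proof. by rewrite /Dyl big1 // => i _; rewrite cpart_cst0 cmul0r. Qed.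

Lemma Dyr0 y : Dyr (fun=> 0 : Cl R m) y = 0.
Proof. by rewrite /Dyr big1 // => i _; rewrite cpart_cst0 cmul0l. Qed.

(** The Clifford relations make the multiplications [t i j] anticommute, while the second partial
    derivatives are symmetric in [i] and [j]. *)
Lemma Dyl_Dyl f y : csmooth f ->
  Dyl (Dyl f) y = - \sum_i cpart i (cpart i f) y.
Proof.
move=> fs; pose t (i j : 'I_m.-1) x := cmul (gen R m (i + 2)) (cmul (gen R m (j + 2)) x).
rewrite -(@sum_anticomm _ _ _ t (fun i j => cpart i (cpart j f) y)).
- apply: eq_bigr => i _; rewrite cpart_sum => [|j]; last first.
    exact: (csmooth_linear (cmul _) (csmooth_cpart j fs)).
  rewrite linear_sum; apply: eq_bigr => j _.
  by rewrite (cpart_linear (cmul _)) //; exact: csmooth_cpart.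
- by move=> i j; exact: cpartC.
- by move=> i x; rewrite /t cmulA gen_sqr ?ord_gen_bound // cmulNl cmul1l.
- move=> i j x ij; rewrite /t !cmulA gen_anticomm ?ord_gen_bound ?eqn_add2r //.
  by rewrite cmulNl.
Qed.

Lemma Dyr_Dyr f y : csmooth f ->
  Dyr (Dyr f) y = - \sum_i cpart i (cpart i f) y.
Proof.
move=> fs; pose t (i j : 'I_m.-1) x := cmul (cmul x (gen R m (j + 2))) (gen R m (i + 2)).
rewrite -(@sum_anticomm _ _ _ t (fun i j => cpart i (cpart j f) y)).
- apply: eq_bigr => i _; rewrite cpart_sum => [|j]; last first.
    exact: (csmooth_linear (cmulr _) (csmooth_cpart j fs)).
  rewrite cmul_suml; apply: eq_bigr => j _.
  by rewrite (cpart_linear (cmulr _)) //; exact: csmooth_cpart.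
- by move=> i j; exact: cpartC.
- by move=> i x; rewrite /t -cmulA gen_sqr ?ord_gen_bound // cmulNr cmul1r.
- move=> i j x ij; rewrite /t -!cmulA gen_anticomm ?ord_gen_bound ?eqn_add2r 1?eq_sym //.
  by rewrite cmulNr.
Qed.

(** By associativity and symmetry of second partial derivatives, both sides are the double sum with
    one generator on each side. *)
Lemma Dyl_Dyr f y : csmooth f -> Dyl (Dyr f) y = Dyr (Dyl f) y.
Proof.
move=> fs; transitivity (\sum_(i < m.-1) \sum_(j < m.-1)
    cmul (cmul (gen R m (i + 2)) (cpart i (cpart j f) y)) (gen R m (j + 2))).
  apply: eq_bigr => i _; rewrite cpart_sum => [|j]; last first.
    exact: (csmooth_linear (cmulr _) (csmooth_cpart j fs)).
  rewrite linear_sum; apply: eq_bigr => j _.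
  by rewrite (cpart_linear (cmulr _)) -?cmulA //; exact: csmooth_cpart.
rewrite exchange_big; apply: eq_bigr => j _ /=; rewrite cpart_sum => [|i]; last first.
  exact: (csmooth_linear (cmul _) (csmooth_cpart i fs)).
rewrite cmul_suml; apply: eq_bigr => i _.
by rewrite (cpart_linear (cmul _)) 1?cpartC //; exact: csmooth_cpart.
Qed.

(** * Multiplication by [e] against the Dirac operators *)

Hypothesis m1 : (1 <= m)%N.
Local Notation e := (gen R m 1).

Lemma gen1_sqr x : cmul e (cmul e x) = - x.
Proof. by rewrite cmulA gen_sqr // cmulNl cmul1l. Qed.

Lemma gen1_sqr_r x : cmul (cmul x e) e = - x.
Proof. by rewrite -cmulA gen_sqr // cmulNr cmul1r. Qed.

Lemma gen1_anticomm i : cmul (gen R m (i + 2)) e = - cmul e (gen R m (i + 2)).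
Proof. by rewrite gen_anticomm ?ord_gen_bound // addn2. Qed.

(** On the operator's own side [e] anticommutes with the generators and costs a sign; on the other
    side associativity lets it pass freely. The next three lemmas follow the same rule. *)
Lemma Dyl_gen1_l f y : csmooth f -> Dyl (fun y => cmul e (f y)) y = - cmul e (Dyl f y).
Proof.
move=> fs; rewrite (@Dyl_linear (cmul e) (-1)) ?scaleN1r // => i x.
by rewrite cmulA gen1_anticomm cmulNl scaleN1r -cmulA.
Qed.

Lemma Dyl_gen1_r f y : csmooth f -> Dyl (fun y => cmul (f y) e) y = cmul (Dyl f y) e.
Proof.
move=> fs; rewrite (@Dyl_linear (cmulr e) 1) ?scale1r // => i x.
by rewrite scale1r /cmulr cmulA.
Qed.

Lemma Dyr_gen1_l f y : csmooth f -> Dyr (fun y => cmul e (f y)) y = cmul e (Dyr f y).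
Proof.
move=> fs; rewrite (@Dyr_linear (cmul e) 1) ?scale1r // => i x.
by rewrite scale1r; exact/esym/cmulA.
Qed.

Lemma Dyr_gen1_r f y : csmooth f -> Dyr (fun y => cmul (f y) e) y = - cmul (Dyr f y) e.
Proof.
move=> fs; rewrite (@Dyr_linear (cmulr e) (-1)) ?scaleN1r // => i x.
rewrite scaleN1r -[RHS]/(- cmul (cmul x _) e) /cmulr.
by rewrite -!cmulA gen1_anticomm cmulNr opprK.
Qed.

End Dirac.

(** * Separation of the variables x0 and x1 *)

Section ExpSplit.
Variables (R : realType) (m : nat).
Hypothesis m2 : (2 <= m)%N.
Implicit Types (P Q A B f : 'rV[R]_m.-1 -> Cl R m) (X : 'rV[R]_m.+1).
Implicit Types (i : 'I_m.-1) (y : 'rV[R]_m.-1).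
Local Notation e := (gen R m 1).

Let m1 : (1 <= m)%N. Proof. exact: ltnW. Qed.

(** Linear maps, sums and partial derivatives (of smooth [P] and [Q] in the [y] directions) preserve
    this shape, so the operators in [X] become operators on the pair [(P, Q)]. *)
Definition exp_split P Q X : Cl R m :=
  (expR (X 0 (inord 0)) * cos (X 0 (inord 1))) *: P (yproj X) +
  (expR (X 0 (inord 0)) * sin (X 0 (inord 1))) *: Q (yproj X).

Lemma Fexp_split A B :
  Fexp A B = exp_split (fun y => A y + B y) (fun y => cmul e (A y - B y)).
Proof.
apply: funext => X; rewrite /Fexp /exp_split /expz /expzbar /cscal -gen0.
rewrite -scaleNr !cmulDl !cmulZl !cmul1l cmulDr cmulNr !scalerDr.
by rewrite scaleNr scalerN addrACA.
Qed.

Lemma exp_split_linear (T : {linear Cl R m -> Cl R m}) P Q X :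
  T (exp_split P Q X) = exp_split (fun y => T (P y)) (fun y => T (Q y)) X.
Proof. by rewrite /exp_split linearD !linearZ. Qed.

Lemma exp_splitD P Q P' Q' X : exp_split P Q X + exp_split P' Q' X =
  exp_split (fun y => P y + P' y) (fun y => Q y + Q' y) X.
Proof. by rewrite /exp_split !scalerDr addrACA. Qed.

Lemma exp_split_sum (J : finType) (P Q : J -> 'rV[R]_m.-1 -> Cl R m) X :
  \sum_j exp_split (P j) (Q j) X =
  exp_split (fun y => \sum_j P j y) (fun y => \sum_j Q j y) X.
Proof. by rewrite /exp_split !scaler_sumr -big_split. Qed.

Lemma inord_eq (a b : nat) : (a <= m)%N -> (b <= m)%N ->
  (inord a == inord b :> 'I_m.+1) = (a == b).
Proof. by move=> am bm; rewrite -val_eqE /= !inordK. Qed.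

Lemma exp_split_eq0 P Q :
  (forall X, exp_split P Q X = 0) <-> (forall y, P y = 0) /\ (forall y, Q y = 0).
Proof.
split=> [F0|[P0 Q0] X]; last by rewrite /exp_split P0 Q0 !scaler0 addr0.
(* The point with [x0 = 0], [x1 = t] and projection [y]: at position [k >= 2] the only nonzero term
   of the sum has [i + 2 = k]. Taking [t = 0] isolates [P], and [t = pi / 2] isolates [Q]. *)
pose X (t : R) y : 'rV[R]_m.+1 :=
  \row_(k < m.+1) if k == inord 0 then 0 else
    if k == inord 1 then t else \sum_i y 0 i *+ (i + 2 == k)%N.
have X0 t y : X t y 0 (inord 0) = 0 by rewrite mxE eqxx.
have X1 t y : X t y 0 (inord 1) = t by rewrite mxE inord_eq // eqxx.
have Xy t y : yproj (X t y) = y.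
  apply/rowP => i; have /andP[_ im] := ord_gen_bound i.
  rewrite mxE mxE !inord_eq // inordK // addn2 /= (bigD1 i) //= addn2 eqxx mulr1n.
  rewrite big1 ?addr0 // => j ji; rewrite addn2 !eqSS.
  by rewrite (negbTE (_ : val j != val i)).
split=> y.
  have := F0 (X 0 y); rewrite /exp_split X0 X1 Xy expR0 cos0 sin0 mulr1 mulr0.
  by rewrite scale1r scale0r addr0.
have := F0 (X (pi / 2) y); rewrite /exp_split X0 X1 Xy expR0 cos_pihalf sin_pihalf.
by rewrite mulr1 mulr0 scale1r scale0r add0r.
Qed.

(** * Partial derivatives of the split form *)

Lemma coord_shift (h : R) X (k j : 'I_m.+1) :
  (h *: delta_mx 0 k + X) 0 j = h * (j == k)%:R + X 0 j.
Proof. by rewrite !mxE eqxx. Qed.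

Lemma yproj_shift (h : R) X (k : nat) : (k < 2)%N ->
  yproj (h *: delta_mx 0 (inord k) + X) = yproj X.
Proof.
move=> k2; apply/rowP => i; have /andP[_ im] := ord_gen_bound i.
have km : (k <= m)%N := leq_trans (ltnW k2) m2.
rewrite !mxE eqxx inord_eq //.
by rewrite addn2 gtn_eqF ?mulr0 ?add0r // (leq_trans k2).
Qed.

Lemma yproj_shift_y (h : R) X i :
  yproj (h *: delta_mx 0 (inord (i + 2)) + X) = h *: delta_mx 0 i + yproj X.
Proof.
apply/rowP => j; have /andP[_ im] := ord_gen_bound i.
have /andP[_ jm] := ord_gen_bound j.
by rewrite !mxE eqxx inord_eq // eqn_add2r.
Qed.

Lemma exp_split_coef P Q S : (fun X => exp_split P Q X S) =
  (fun X => expR (X 0 (inord 0)) * cos (X 0 (inord 1)) * P (yproj X) S +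
            expR (X 0 (inord 0)) * sin (X 0 (inord 1)) * Q (yproj X) S).
Proof. by apply: funext => X; rewrite !ffunE. Qed.

Lemma cpart_exp_split0 P Q X :
  cpart (inord 0) (exp_split P Q) X = exp_split P Q X.
Proof.
apply/ffunP => S; rewrite ffunE exp_split_coef.
rewrite (congr1 (@^~ X) (exp_split_coef P Q S)).
apply: derive_val; set x0 := X 0 (inord 0); set x1 := X 0 (inord 1).
pose c := cos x1 * P (yproj X) S + sin x1 * Q (yproj X) S.
apply: (@is_derive_reparam _ _ R _ _ (fun t => c * expR t) _ _ x0 1) => [h|].
  rewrite !coord_shift yproj_shift // eqxx inord_eq // mulr1 mulr0 add0r.
  by rewrite -[h *: 1]/(h * 1) mulr1 -/x0 -/x1 /c; ring.
apply: (is_derive_eq (is_deriveZ c (is_derive_expR x0))).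
by rewrite /c -[LHS]/(_ * _); ring.
Qed.

(** Freezing the other coordinates leaves [a * cos t + b * sin t], whose derivative replaces
    [(a, b)] by [(b, -a)]. *)
Lemma cpart_exp_split1 P Q X :
  cpart (inord 1) (exp_split P Q) X = exp_split Q (fun y => - P y) X.
Proof.
apply/ffunP => S; rewrite ffunE exp_split_coef.
rewrite (congr1 (@^~ X) (exp_split_coef Q _ S)).
apply: derive_val; set x0 := X 0 (inord 0); set x1 := X 0 (inord 1).
pose a := expR x0 * P (yproj X) S; pose b := expR x0 * Q (yproj X) S.
apply: (@is_derive_reparam _ _ R _ _ (fun t => a * cos t + b * sin t) _ _ x1 1) => [h|].
  rewrite !coord_shift yproj_shift // eqxx inord_eq // mulr1 mulr0 add0r.
  by rewrite -[h *: 1]/(h * 1) mulr1 -/x0 -/x1 /a /b; ring.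
apply: (is_derive_eq (is_deriveD (is_deriveZ a (is_derive_cos x1))
  (is_deriveZ b (is_derive_sin x1)))).
by rewrite -[LHS]/(a * _ + b * _) [(- P _) S]ffunE /a /b; ring.
Qed.

Lemma cpart_exp_split P Q X i : csmooth P -> csmooth Q ->
  cpart (inord (i + 2)) (exp_split P Q) X = exp_split (cpart i P) (cpart i Q) X.
Proof.
move=> /csmoothP Ps /csmoothP Qs; apply/ffunP => S; rewrite ffunE exp_split_coef.
rewrite (congr1 (@^~ X) (exp_split_coef _ _ S)).
apply: derive_val; have /andP[_ im] := ord_gen_bound i.
set a := expR _ * cos _; set b := expR _ * sin _.
apply: (@is_derive_reparam _ _ _ _ _ ((a \*: (fun y => P y S)) + (b \*: (fun y => Q y S)))
  _ _ (yproj X) (delta_mx 0 i)) => [h|].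
  by rewrite !coord_shift yproj_shift_y !inord_eq // addn2 !mulr0 !add0r.
rewrite [cpart i P _ _]ffunE [cpart i Q _ _]ffunE.
by apply: is_deriveD; apply: is_deriveZ; exact/derivableP/smooth_derivable.
Qed.

(** Separates [x0] and [x1] from the coordinates of [y], with the index shift by 2 used in [Dyl] and
    [Dyr]. *)
Lemma big_ord_split (V : zmodType) (H : 'I_m.+1 -> V) :
  \sum_k H k = H (inord 0) + H (inord 1) + \sum_(i < m.-1) H (inord (i + 2)).
Proof.
case: m m2 H => [|[|n]] // _ H; rewrite 2!big_ord_recl addrA; congr (H _ + H _ + _).
- by apply: val_inj; rewrite /= inordK.
- by apply: val_inj; rewrite /= inordK.
apply: eq_bigr => i _; congr (H _); apply: val_inj.
by rewrite addn2 /= inordK //; exact: (ltn_ord i).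
Qed.

(** The pair [(P, Q)] comes from [x0], the pair [(e Q, - e P)] from [x1], and [(Dyl P, Dyl Q)] from
    the remaining coordinates. *)
Lemma DXl_exp_split P Q X : csmooth P -> csmooth Q ->
  DXl (exp_split P Q) X = exp_split (fun y => P y + cmul e (Q y) + Dyl P y)
    (fun y => Q y - cmul e (P y) + Dyl Q y) X.
Proof.
move=> Ps Qs; rewrite /DXl big_ord_split !inordK // cpart_exp_split0 cpart_exp_split1.
rewrite cmul1l exp_split_linear.
under eq_bigr => i _.
  have /andP[_ im] := ord_gen_bound i.
  rewrite inordK // cpart_exp_split // exp_split_linear.
  over.
rewrite exp_split_sum !exp_splitD; congr (exp_split _ _ X).
by apply: funext => y; congr (_ + _ + _); exact: cmulNr.
Qed.

Lemma DXr_exp_split P Q X : csmooth P -> csmooth Q ->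
  DXr (exp_split P Q) X = exp_split (fun y => P y + cmul (Q y) e + Dyr P y)
    (fun y => Q y - cmul (P y) e + Dyr Q y) X.
Proof.
move=> Ps Qs; rewrite /DXr big_ord_split !inordK // cpart_exp_split0 cpart_exp_split1.
rewrite cmul1r [cmul (exp_split _ _ _) _](exp_split_linear (cmulr _)).
under eq_bigr => i _.
  have /andP[_ im] := ord_gen_bound i.
  rewrite inordK // cpart_exp_split //.
  rewrite [cmul (exp_split _ _ _) _](exp_split_linear (cmulr _)).
  over.
rewrite exp_split_sum !exp_splitD; congr (exp_split _ _ X).
by apply: funext => y; congr (_ + _ + _); exact: cmulNl.
Qed.

End ExpSplit.

(** * Monogenicity of the exponential ansatz *)

Section Criterion.
Variables (R : realType) (m : nat).
Hypothesis m2 : (2 <= m)%N.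
Implicit Types (A B M : 'rV[R]_m.-1 -> Cl R m) (y : 'rV[R]_m.-1).
Local Notation e := (gen R m 1).

Let m1 : (1 <= m)%N. Proof. exact: ltnW. Qed.

Lemma gen1_mul_eq0 (x : Cl R m) : cmul e x = 0 -> x = 0.
Proof.
move=> /(congr1 (cmul e)); rewrite gen1_sqr // cmul0r => /eqP.
by rewrite oppr_eq0 => /eqP.
Qed.

Lemma csmooth_gen1_l A : csmooth A -> csmooth (fun y => cmul e (A y)).
Proof. exact: (csmooth_linear (cmul e)). Qed.

Lemma csmooth_gen1_r A : csmooth A -> csmooth (fun y => cmul (A y) e).
Proof. exact: (csmooth_linear (cmulr e)). Qed.

(** With [u = 2 B + Dyl A] and [w = Dyl B], the cosine component of [DXl] is [u + w] and the sine
    component is [- e (u - w)]; [e] is invertible. *)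
Lemma left_monogenic_Fexp A B : csmooth A -> csmooth B ->
  (forall X, DXl (Fexp A B) X = 0) <->
  (forall y, B y + B y + Dyl A y = 0) /\ (forall y, Dyl B y = 0).
Proof.
move=> As Bs; have Ps := csmoothD As Bs; have Ds := csmoothB As Bs.
have Qs := csmooth_gen1_l Ds.
have E1 y : A y + B y + cmul e (cmul e (A y - B y)) + Dyl (fun y => A y + B y) y =
    (B y + B y + Dyl A y) + Dyl B y.
  rewrite gen1_sqr // DylD //; move: (A y) (B y) (Dyl A y) (Dyl B y) => a b a' b'.
  by apply/ffunP => S; rewrite !ffunE; ring.
have E2 y : cmul e (A y - B y) - cmul e (A y + B y) +
    Dyl (fun y => cmul e (A y - B y)) y = - cmul e ((B y + B y + Dyl A y) - Dyl B y).
  rewrite Dyl_gen1_l // DylB // -!cmulNr -!cmulDr; congr cmul.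
  move: (A y) (B y) (Dyl A y) (Dyl B y) => a b a' b'.
  by apply/ffunP => S; rewrite !ffunE; ring.
rewrite Fexp_split; split=> [F0|[u0 w0] X]; last first.
  rewrite DXl_exp_split //; apply/(exp_split_eq0 m2): X.
  by split=> y; rewrite ?E1 ?E2 u0 w0 ?subr0 ?addr0 ?cmul0r ?oppr0.
have /(exp_split_eq0 m2)[P0 Q0] : forall X, exp_split _ _ X = 0 :=
  fun X => etrans (esym (DXl_exp_split m2 X Ps Qs)) (F0 X).
have uw y : B y + B y + Dyl A y = 0 /\ Dyl B y = 0.
  apply/add_sub_eq0; split; first by rewrite -E1 P0.
  by apply: gen1_mul_eq0; apply: oppr_inj; rewrite -E2 Q0 oppr0.
by split=> y; have [] := uw y.
Qed.

(** With [u] and [w] the left-hand sides of the two equations, the components of [DXr] are [u + w]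
    and [e (u - w)]. *)
Lemma right_monogenic_Fexp A B : csmooth A -> csmooth B ->
  (forall X, DXr (Fexp A B) X = 0) <->
  (forall y, A y + cmul (cmul e (A y)) e + Dyr A y = 0) /\
  (forall y, B y - cmul (cmul e (B y)) e + Dyr B y = 0).
Proof.
move=> As Bs; have Ps := csmoothD As Bs; have Ds := csmoothB As Bs.
have Qs := csmooth_gen1_l Ds.
have E1 y : A y + B y + cmul (cmul e (A y - B y)) e + Dyr (fun y => A y + B y) y =
    (A y + cmul (cmul e (A y)) e + Dyr A y) + (B y - cmul (cmul e (B y)) e + Dyr B y).
  rewrite DyrD // cmulDr cmulNr cmulDl cmulNl.
  move: (A y) (B y) (Dyr A y) (Dyr B y) (cmul (cmul e _) e) (cmul (cmul e _) e).
  by move=> a b a' b' c d; apply/ffunP => S; rewrite !ffunE; ring.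
have E2 y : cmul e (A y - B y) - cmul (A y + B y) e +
    Dyr (fun y => cmul e (A y - B y)) y =
    cmul e ((A y + cmul (cmul e (A y)) e + Dyr A y) -
            (B y - cmul (cmul e (B y)) e + Dyr B y)).
  rewrite Dyr_gen1_l // DyrB // -cmulNl.
  (* Writing [- (A + B)] as [e e (A + B)] exposes the common left factor [e]. *)
  rewrite -(gen1_sqr m1 (A y + B y)) -cmulA -!cmulDr; congr cmul.
  rewrite cmulDr cmulDl.
  move: (A y) (B y) (Dyr A y) (Dyr B y) (cmul (cmul e _) e) (cmul (cmul e _) e).
  by move=> a b a' b' c d; apply/ffunP => S; rewrite !ffunE; ring.
rewrite Fexp_split; split=> [F0|[u0 w0] X]; last first.
  rewrite DXr_exp_split //; apply/(exp_split_eq0 m2): X.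
  by split=> y; rewrite ?E1 ?E2 u0 w0 ?subr0 ?addr0 ?cmul0r.
have /(exp_split_eq0 m2)[P0 Q0] : forall X, exp_split _ _ X = 0 :=
  fun X => etrans (esym (DXr_exp_split m2 X Ps Qs)) (F0 X).
have uw y : A y + cmul (cmul e (A y)) e + Dyr A y = 0 /\
            B y - cmul (cmul e (B y)) e + Dyr B y = 0.
  apply/add_sub_eq0; split; first by rewrite -E1 P0.
  by apply: gen1_mul_eq0; rewrite -E2 Q0.
by split=> y; have [] := uw y.
Qed.

(** Only the factor [e] on the operator's side contributes a sign. *)
Lemma Dyl_conj A y : csmooth A ->
  Dyl (fun y => cmul (cmul e (A y)) e) y = - cmul (cmul e (Dyl A y)) e.
Proof.
move=> As; rewrite Dyl_gen1_r ?Dyl_gen1_l ?cmulNl //; exact: csmooth_gen1_l.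
Qed.

Lemma Dyr_conj A y : csmooth A ->
  Dyr (fun y => cmul (cmul e (A y)) e) y = - cmul (cmul e (Dyr A y)) e.
Proof.
move=> As; rewrite Dyr_gen1_r ?Dyr_gen1_l //; exact: csmooth_gen1_l.
Qed.

Lemma csmooth_conj A : csmooth A -> csmooth (fun y => cmul (cmul e (A y)) e).
Proof. by move=> As; apply: csmooth_gen1_r; exact: csmooth_gen1_l. Qed.

Lemma conj_conj (x : Cl R m) : cmul (cmul e (cmul (cmul e x) e)) e = x.
Proof. by rewrite cmulA gen1_sqr // gen1_sqr_r // opprK. Qed.

(* The second right equation follows from the first one: applying [Dyl] to
   [A + e A e + Dyr A = 0] gives [C - e C e + Dyr C = 0] for [C = Dyl A], as
   [Dyl] anticommutes with left multiplication by [e] and commutes with [Dyr]. *)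
Lemma right_equation_Dyl A y : csmooth A ->
  (forall z, A z + cmul (cmul e (A z)) e + Dyr A z = 0) ->
  Dyl A y - cmul (cmul e (Dyl A y)) e + Dyr (Dyl A) y = 0.
Proof.
move=> As A0; have Cs := csmooth_conj As.
rewrite -Dyl_Dyr // -Dyl_conj // -DylD // -DylD; first last.
- exact: csmooth_Dyr.
- exact: csmoothD.
by rewrite -[RHS](@Dyl0 R m y); congr (Dyl _ y); apply: funext.
Qed.

Lemma two_sided_monogenic_FexpP A B : csmooth A -> csmooth B ->
  two_sided_monogenic (Fexp A B) <->
  (harmonic_y A /\ (forall y, A y + cmul (cmul e (A y)) e + Dyr A y = 0)) /\
  (left_monogenic_y B /\ (forall y, B y = - (2^-1 : R) *: Dyl A y)).
Proof.
move=> As Bs; have DAs := csmooth_Dyl As.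
have half0 : - (2^-1 : R) != 0 by rewrite oppr_eq0 invr_eq0 pnatr_eq0.
split.
  move=> [/(left_monogenic_Fexp As Bs)[BA B0] /(right_monogenic_Fexp As Bs)[A0 _]].
  have BE y : B y = - (2^-1 : R) *: Dyl A y by exact/double_half_eq.
  (* Minus the Laplacian of [A] is [Dyl (Dyl A)], which vanishes because [Dyl A] is a multiple of
     [B] and [Dyl B = 0]. *)
  split; split=> // y; apply: oppr_inj; rewrite -Dyl_Dyl // oppr0.
  apply: (scalerI half0); rewrite scaler0 -DylZ // -[RHS](B0 y); congr (Dyl _ y).
  by apply: funext => z; rewrite BE.
move=> [[_ A0] [B0 BE]]; split.
  by apply/(left_monogenic_Fexp As Bs); split=> // y; apply/double_half_eq.
apply/(right_monogenic_Fexp As Bs); split=> // y.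
(* The equation is linear in [B], so it reduces to the one for [Dyl A]. *)
have -> : B = (fun z => - (2^-1 : R) *: Dyl A z) by exact: funext.
rewrite DyrZ // cmulZr cmulZl -scalerBr -scalerDr right_equation_Dyl //.
exact: scaler0.
Qed.

(** An instance of the criterion: for [A = M - e M e] one has [e A e = - A], [Dyr A = 0], and
    [Dyl A] is the bracket defining [B]. *)
Lemma two_sided_monogenic_of_right M : csmooth M -> right_monogenic_y M ->
  two_sided_monogenic
    (Fexp (fun y => M y - cmul (cmul e (M y)) e)
          (fun y => - (2^-1 : R) *: (Dyl M y + cmul (cmul e (Dyl M y)) e))).
Proof.
move=> Ms M0; have Cs := csmooth_conj Ms; have DMs := csmooth_Dyl Ms.
have As : csmooth (fun y => M y - cmul (cmul e (M y)) e) by exact: csmoothB.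
have DAE y : Dyl (fun y => M y - cmul (cmul e (M y)) e) y =
             Dyl M y + cmul (cmul e (Dyl M y)) e.
  by rewrite DylB // Dyl_conj // opprK.
have Bs : csmooth (fun y => - (2^-1 : R) *: (Dyl M y + cmul (cmul e (Dyl M y)) e)).
  by apply: csmoothZ; apply: csmoothD => //; exact: csmooth_conj.
(* Left and right Dirac operators have the same square, so [Dyr M = 0] forces this. *)
have DDM y : Dyl (Dyl M) y = 0.
  rewrite Dyl_Dyl // -Dyr_Dyr // -[RHS](@Dyr0 R m y); congr (Dyr _ y).
  exact: funext.
have DDA y : Dyl (fun y => Dyl M y + cmul (cmul e (Dyl M y)) e) y = 0.
  rewrite DylD //; last exact: csmooth_conj.
  by rewrite Dyl_conj // DDM cmul0r cmul0l subr0.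
apply/(two_sided_monogenic_FexpP As Bs); split; split=> y; last by rewrite DAE.
- apply: oppr_inj; rewrite -Dyl_Dyl // oppr0 -(DDA y); congr (Dyl _ y).
  exact: funext.
- rewrite DyrB // Dyr_conj // M0 cmul0r cmul0l !oppr0 !addr0 cmulDr cmulNr.
  by rewrite cmulDl cmulNl conj_conj addrA subrK subrr.
- rewrite DylZ ?DDA ?scaler0 //.
  by apply: csmoothD => //; exact: csmooth_conj.
Qed.

End Criterion.

Unset Implicit Arguments.

Theorem theorem1 (R : realType) (m : nat) (hm : (2 <= m)%N) :
  (forall A B : 'rV[R]_(m.-1) -> Cl R m, csmooth A -> csmooth B ->
    (two_sided_monogenic (Fexp A B) <->
      (harmonic_y A /\
       (forall y, A y + cmul (cmul (gen R m 1) (A y)) (gen R m 1) + Dyr A y = 0)) /\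
      (left_monogenic_y B /\ (forall y, B y = - (2^-1 : R) *: Dyl A y))))
  /\
  (forall M : 'rV[R]_(m.-1) -> Cl R m, csmooth M -> right_monogenic_y M ->
    two_sided_monogenic
      (Fexp (fun y => M y - cmul (cmul (gen R m 1) (M y)) (gen R m 1))
            (fun y => - (2^-1 : R) *:
                (Dyl M y + cmul (cmul (gen R m 1) (Dyl M y)) (gen R m 1))))).
Proof.
split=> [A B|M]; first exact: two_sided_monogenic_FexpP.
exact: two_sided_monogenic_of_right.
Qed.
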